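(* Let $\alpha\in(0,1)$, let $\Omega\subset\mathbb{R}^n$ be an open set and let $E\subset\mathbb{R}^n$ be a measurable set such that $\tilde P_\alpha(E;\Omega)<+\infty$. Consider the inequality $$\|\nabla^\alpha\chi_E\|_{L^1(\Omega;\,\mathbb{R}^n)}\le\mu_{n,\alpha}\,\tilde P_\alpha(E;\Omega).\qquad( * )$$ (i) If $n\ge2$, $\mathcal{L}^n(E)>0$ and $\mathcal{L}^n(\mathbb{R}^n\setminus E)>0$, then inequality $( * )$ is strict. (ii) If $n=1$, then $( * )$ is an equality if and only if both of the following hold: (a) for a.e. $x\in\Omega\cap E$, $\mathcal{L}^1((-\infty,x)\setminus E)=0$ or $\mathcal{L}^1((x,+\infty)\setminus E)=0$ (inclusive or); (b) for a.e. $x\in\Omega\setminus E$, $\mathcal{L}^1((-\infty,x)\cap E)=0$ or $\mathcal{L}^1((x,+\infty)\cap E)=0$ (inclusive or).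
   Context: $\mathcal{L}^n$ is Lebesgue measure on $\mathbb{R}^n$, and $\chi_E$ is the characteristic function of $E$. For $\alpha\in(0,1)$, $\mu_{n,\alpha}:=2^\alpha\pi^{-n/2}\,\Gamma\big(\tfrac{n+\alpha+1}{2}\big)/\Gamma\big(\tfrac{1-\alpha}{2}\big)$, where $\Gamma$ is Euler's Gamma function. For $\Omega\subset\mathbb{R}^n$ open and $E\subset\mathbb{R}^n$ measurable, $$\tilde P_\alpha(E;\Omega):=\int_\Omega\int_\Omega\frac{|\chi_E(y)-\chi_E(x)|}{|y-x|^{n+\alpha}}\,dx\,dy+\int_{\mathbb{R}^n\setminus\Omega}\int_\Omega\frac{|\chi_E(y)-\chi_E(x)|}{|y-x|^{n+\alpha}}\,dx\,dy.$$ When this is finite, for a.e. $x\in\Omega$ the fractional $\alpha$-gradient of $\chi_E$ is given by the absolutely convergent integral $$\nabla^\alpha\chi_E(x):=\mu_{n,\alpha}\int_{\mathbb{R}^n}\frac{(y-x)(\chi_E(y)-\chi_E(x))}{|y-x|^{n+\alpha+1}}\,dy.$$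
   Formalization: In part (i) the open set Ω is additionally assumed nonempty, since for Ω = ∅ both sides of ( * ) are 0 and strict inequality fails; part (ii) is unchanged. *)

(* Defs.v *)
From HB Require Import structures.
From mathcomp Require Import all_boot all_order all_algebra.
From mathcomp Require Import all_classical all_reals all_analysis.

Set Implicit Arguments.
Unset Strict Implicit.
Unset Printing Implicit Defensive.

Import Order.TTheory GRing.Theory Num.Theory.
Import numFieldNormedType.Exports.

Local Open Scope classical_set_scope.
Local Open Scope ring_scope.

(* The norm `|x| that the library puts on 'rV[R]_n is the sup norm; it has the
   same open sets as enorm, so [open] below is the usual notion. *)
Definition enorm (R : realType) (n : nat) (x : 'rV[R]_n) : R :=
  Num.sqrt (\sum_i x 0 i ^+ 2).

Section lebesgue_measure_Rn.
Context (R : realType) (n : nat).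
Implicit Types (A : set 'rV[R]_n) (ab : 'rV[R]_n * 'rV[R]_n).

Definition box ab : set 'rV[R]_n :=
  [set x | forall i, ab.1 0 i < x 0 i <= ab.2 0 i].

(* The maximum makes the volume vanish when some side of the box is empty. *)
Definition box_vol ab : R := \prod_i Num.max 0 (ab.2 0 i - ab.1 0 i).

Lemma box_vol_ge0 ab : 0 <= box_vol ab.
Proof. by apply: prodr_ge0 => i _; rewrite le_max lexx. Qed.

(* Covers by at most countably many boxes. The index set F.1 may be finite or
   empty, so that the empty set has outer measure 0 also when n = 0, where
   every box is a point of volume 1. *)
Definition box_cover A : set (set nat * (nat -> 'rV[R]_n * 'rV[R]_n)) :=
  [set F | A `<=` \bigcup_(k in F.1) box (F.2 k)].

Definition lebesgue_outer A : \bar R :=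
  ereal_inf [set \esum_(k in F.1) (box_vol (F.2 k))%:E | F in box_cover A].

Lemma lebesgue_outer_ge0 A : (0 <= lebesgue_outer A)%E.
Proof.
apply: le_ereal_inf_tmp => _ [F _ <-]; apply: esum_ge0 => k _.
by rewrite lee_fin box_vol_ge0.
Qed.

Lemma lebesgue_outer0 : lebesgue_outer set0 = 0%E.
Proof.
apply/eqP; rewrite eq_le lebesgue_outer_ge0 andbT.
apply: ereal_inf_lbound; exists (set0, fun=> 0) => //=.
exact: esum_set0.
Qed.

Lemma le_lebesgue_outer :
  {homo lebesgue_outer : A B / A `<=` B >-> (A <= B)%E}.
Proof.
move=> A B AB; apply/ereal_inf_le_tmp => _ [F BF <-].
by exists F => //; exact: subset_trans BF.
Qed.

Lemma lebesgue_outer_sigma_subadditive : sigma_subadditive lebesgue_outer.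
Proof.
move=> A; have [[i ioo]|] := pselect (exists i, lebesgue_outer (A i) = +oo%E).
  rewrite (eseries_pinfty _ _ ioo) ?leey// => k _.
  by rewrite -ltNye (lt_le_trans _ (lebesgue_outer_ge0 _)).
rewrite -forallNE => Aoo.
apply/lee_addgt0Pr => e e0.
apply: (le_trans _ (epsilon_trick _ _ (ltW e0))); last first.
  by move=> k; exact: lebesgue_outer_ge0.
pose P k F := box_cover (A k) F /\
  (\esum_(j in F.1) (box_vol (F.2 j))%:E
     <= lebesgue_outer (A k) + (e / (2 ^ k.+1)%:R)%:E)%E.
have [G PG] : {G & forall k, P k (G k)}.
  apply: (@choice _ _ P) => k.
  have fin : lebesgue_outer (A k) \is a fin_num.
    by rewrite ge0_fin_numE ?lebesgue_outer_ge0// ltey; apply/eqP/Aoo.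
  have ek0 : 0 < e / (2 ^ k.+1)%:R by rewrite divr_gt0// ltr0n expn_gt0.
  have [x [F AF <-] xS] := lb_ereal_inf_adherent ek0 fin.
  by exists F; split => //; exact/ltW.
pose J k := (G k).1.
pose a k j := (box_vol ((G k).2 j))%:E.
have a0 k j : (0 <= a k j)%E by rewrite lee_fin box_vol_ge0.
apply: (@le_trans _ _ (\esum_(k in [set: nat]) \esum_(j in J k) a k j)%E).
  rewrite esum_esum//.
  have /card_esym/ppcard_eqP[f] := card_nat2.
  have fbij : set_bij (f @^-1` ([set: nat] `*`` J)) ([set: nat] `*`` J) f.
    split.
    - by [].
    - by move=> x y _ _; apply: inj; rewrite inE.
    - by move=> p Jp; exists (f^-1%FUN p); rewrite /= invK ?inE.
  rewrite (reindex_esum _ _ _ _ fbij).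
  apply: ereal_inf_lbound.
  exists (f @^-1` ([set: nat] `*`` J), fun i => (G (f i).1).2 (f i).2) => //.
  move=> t [k _ /(PG k).1[j Jj tj]] /=.
  by exists (f^-1%FUN (k, j)); rewrite /= invK ?inE.
have S0 k : (0 <= \esum_(j in J k) a k j)%E by apply: esum_ge0 => j _.
rewrite -nneseries_esumT//.
by apply: lee_nneseries => k *; [exact: S0|exact: (PG k).2].
Qed.

HB.instance Definition _ := isOuterMeasure.Build R 'rV[R]_n lebesgue_outer
  lebesgue_outer0 lebesgue_outer_ge0 le_lebesgue_outer
  lebesgue_outer_sigma_subadditive.

(* 'rV[R]_n with the sigma-algebra of its Lebesgue measurable sets *)
Definition lebesgueRn_type := caratheodory_type lebesgue_outer.

HB.instance Definition _ := Measurable.on lebesgueRn_type.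

Definition lebesgueRn : set lebesgueRn_type -> \bar R := lebesgue_outer.

Let mu0 : lebesgueRn set0 = 0%E.
Proof. exact: lebesgue_outer0. Qed.

Let mu_ge0 A : (0 <= lebesgueRn A)%E.
Proof. exact: lebesgue_outer_ge0. Qed.

Let mu_sigma_additive : semi_sigma_additive lebesgueRn.
Proof. by move=> *; exact: caratheodory_measure_sigma_additive. Qed.

HB.instance Definition _ := isMeasure.Build _ lebesgueRn_type R lebesgueRn
  mu0 mu_ge0 mu_sigma_additive.

End lebesgue_measure_Rn.

Arguments lebesgueRn_type R n : clear implicits.
Arguments lebesgueRn {R n}.

Section fractional_variation.
Context (R : realType).

(* Euler's integral, used only for s > 0. *)
Definition Gamma (s : R) : R :=
  \int[lebesgue_measure]_(t in `]0, +oo[) (t `^ (s - 1) * expR (- t)).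

Definition mu_const (n : nat) (alpha : R) : R :=
  2 `^ alpha * pi `^ (- (n%:R / 2)) *
  Gamma ((n%:R + alpha + 1) / 2) / Gamma ((1 - alpha) / 2).

Definition frac_kernel (n : nat) (alpha : R) (E : set 'rV[R]_n)
    (x y : 'rV[R]_n) : R :=
  `|\1_E y - \1_E x| / enorm (y - x) `^ (n%:R + alpha).

Definition frac_perimeter (n : nat) (alpha : R) (E Omega : set 'rV[R]_n)
    : \bar R :=
  (\int[lebesgueRn]_(y in Omega) \int[lebesgueRn]_(x in Omega)
     (frac_kernel alpha E x y)%:E
   + \int[lebesgueRn]_(y in ~` Omega) \int[lebesgueRn]_(x in Omega)
     (frac_kernel alpha E x y)%:E)%E.

(* The integral is taken componentwise, with a real-valued integral that has a
   junk value at the points x where it does not converge absolutely. *)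
Definition frac_gradient (n : nat) (alpha : R) (E : set 'rV[R]_n)
    (x : 'rV[R]_n) : 'rV[R]_n :=
  mu_const n alpha *: \row_i \int[lebesgueRn]_y
    ((y - x) 0 i * (\1_E y - \1_E x) / enorm (y - x) `^ (n%:R + alpha + 1)).

Definition L1norm (n : nat) (Omega : set 'rV[R]_n)
    (F : 'rV[R]_n -> 'rV[R]_n) : \bar R :=
  \int[lebesgueRn]_(x in Omega) (enorm (F x))%:E.

End fractional_variation.

(* Main.v *)
(* For x in Omega, the gradient is mu times the integral over y of a vector field
   whose Euclidean norm is the kernel |chi_E(y) - chi_E(x)| / |y - x|^(n+alpha).
   By Tonelli the perimeter is the integral over Omega of the mass K(x) of this
   kernel, so ( * ) follows from |int g| <= int |g|, with equality iff
   |int g| = int |g| for a.e. x in Omega. By Cauchy-Schwarz this forces g to have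
   a constant direction: a.e. y with chi_E(y) != chi_E(x) lies on one ray issued
   from x. If n >= 2 a ray is null, so E or its complement is null; if n = 1 the
   rays are the two half-lines, which is the stated criterion. *)

Require Import Defs.
From HB Require Import structures.
From mathcomp Require Import all_boot all_order all_algebra.
From mathcomp Require Import all_classical all_reals all_analysis.
From mathcomp Require Import measurable_realfun ring lra.

Import Order.TTheory GRing.Theory Num.Theory.
Import numFieldNormedType.Exports.

Local Open Scope classical_set_scope.
Local Open Scope ring_scope.

Set Implicit Arguments.
Unset Strict Implicit.

(** * Lebesgue measure on R^n *)

(** The measure comes from box covers, and a box is only bounded above in measure, by its volume;
    translation invariance supplies the rest. A hyperplane is null because infinitely many disjoint
    translates of each bounded piece fit in one box. A nonempty open set is not null because
    countably many of its translates cover the space, which has positive measure as soon as [E] has;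
    this is what makes a pointwise contradiction in [Omega] yield strictness in (i). The constant mu
    has to be positive to be cancelled, and [Gamma] is a real-valued integral that would default to
    0 if it diverged, so convergence is proved along with positivity. The direction of g is found by
    testing g against its own integral G: |G|^2 = int <G, g> <= |G| int |g|. The case G = 0 gives no
    direction and is treated apart: equality then forces K(x) = 0. For n >= 2 the ray is enlarged to
    a hyperplane, given by two coordinates of G. *)

Definition set_coord (R : realType) (n : nat) (i : 'I_n) (v : 'rV[R]_n) (t : R)
  : 'rV[R]_n := \row_j (if j == i then t else v 0 j).

(** Only the factor of index [i] changes, so the claim is about an interval ]a, b] cut at c. The
    truncation at 0 covers a c outside the interval and empty sides. *)
Lemma box_vol_split (R : realType) (n : nat) (i : 'I_n) (c : R)
    (ab : 'rV[R]_n * 'rV[R]_n) :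
  box_vol (ab.1, set_coord i ab.2 (Num.min (ab.2 0 i) c)) +
  box_vol (set_coord i ab.1 (Num.max (ab.1 0 i) c), ab.2) = box_vol ab.
Proof.
rewrite /box_vol (bigD1 i) // [X in _ + X](bigD1 i) // [RHS](bigD1 i) //=.
rewrite /set_coord !mxE eqxx; set P := \prod_(j | j != i) Num.max 0 (ab.2 0 j - ab.1 0 j).
rewrite (_ : _ + _ =
    Num.max 0 (Num.min (ab.2 0 i) c - ab.1 0 i) * P
    + Num.max 0 (ab.2 0 i - Num.max (ab.1 0 i) c) * P); last first.
  by congr (_ * _ + _ * _); apply: eq_bigr => j /negbTE ji; rewrite !mxE ji.
rewrite -mulrDl; congr (_ * _).
move: (ab.1 0 i) (ab.2 0 i) => a b.
case: (leP b c) => bc; case: (leP a c) => ac;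
  do ?[case: leP => ?]; lra.
Qed.

(** Cutting each box of a cover of [X] at height [c] yields covers of the two parts of [X] with the
    same total volume, which is the Caratheodory criterion. *)
Lemma measurable_halfspace (R : realType) (n : nat) (i : 'I_n) (c : R) :
  measurable ([set x | x 0 i <= c] : set (lebesgueRn_type R n)).
Proof.
apply: le_caratheodory_measurable => X; set H := [set x | _].
apply: le_ereal_inf_tmp => _ [F XF <-].
pose F1 k := ((F.2 k).1,
  set_coord i (F.2 k).2 (Num.min ((F.2 k).2 0 i) c)).
pose F2 k := (set_coord i (F.2 k).1 (Num.max ((F.2 k).1 0 i) c), (F.2 k).2).
have -> : (\esum_(k in F.1) (box_vol (F.2 k))%:E =
    \esum_(k in F.1) (box_vol (F1 k))%:E + \esum_(k in F.1) (box_vol (F2 k))%:E)%E.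
  rewrite -esumD; try by move=> *; rewrite lee_fin box_vol_ge0.
  by apply: eq_esum => k _; rewrite -EFinD box_vol_split.
apply: leeD; apply: ereal_inf_lbound.
- exists (F.1, F1) => // x [/XF[k Fk xk] Hx]; exists k => // j.
  rewrite /= /set_coord mxE; have /andP[-> xj] := xk j.
  by case: eqVneq => [->|//]; rewrite le_min; have /andP[_ ->] := xk i.
- exists (F.1, F2) => // x [/XF[k Fk xk] /negP Hx]; exists k => // j.
  rewrite /= /set_coord mxE; have /andP[xj ->] := xk j.
  rewrite andbT; case: eqVneq => [->|//]; rewrite gt_max.
  by have /andP[-> _] := xk i; rewrite ltNge.
Qed.

Lemma measurable_coord (R : realType) (n : nat) (i : 'I_n) :
  measurable_fun setT (fun x : lebesgueRn_type R n => (x : 'rV[R]_n) 0 i).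
Proof.
apply: (measurability _ (RGenOInfty.measurableE R)).
move=> _ [_ [r ->] <-]; rewrite setTI (_ : _ @^-1` _ =
  ~` [set x : lebesgueRn_type R n | (x : 'rV[R]_n) 0 i <= r]).
  by apply: measurableC; exact: measurable_halfspace.
by apply/seteqP; split=> x /=; rewrite in_itv /= andbT ltNge => /negP.
Qed.

Lemma measurable_box (R : realType) (n : nat) (ab : 'rV[R]_n * 'rV[R]_n) :
  measurable (box ab : set (lebesgueRn_type R n)).
Proof.
rewrite (_ : box ab = \bigcap_(i in [set: 'I_n])
  ((fun x : lebesgueRn_type R n => (x : 'rV[R]_n) 0 i) @^-1` `]ab.1 0 i, ab.2 0 i])).
  apply: fin_bigcap_measurable; first exact: finite_finset.
  move=> i _; rewrite -[X in measurable X]setTI; exact: measurable_coord.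
by apply/seteqP; split=> x /= xb i => [_|]; have := xb i; rewrite /= in_itv //=; apply.
Qed.

Lemma lebesgueRn_box_lty (R : realType) (n : nat) (ab : 'rV[R]_n * 'rV[R]_n) :
  (lebesgueRn (box ab) < +oo)%E.
Proof.
apply: (@le_lt_trans _ _ (\esum_(k in [set 0%N]) (box_vol ab)%:E)%E).
  apply: ereal_inf_lbound; exists ([set 0%N], fun=> ab) => //.
  by move=> x abx; exists 0%N.
by rewrite esum_set1 ?ltry// lee_fin box_vol_ge0.
Qed.

Lemma bigcup_centered_box (R : realType) (n : nat) :
  \bigcup_k box (const_mx (- k%:R), const_mx k%:R) = [set: 'rV[R]_n].
Proof.
rewrite -subTset => x _.
exists (Num.truncn (\sum_i `|x 0 i|)).+1 => // i /=; rewrite !mxE.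
have xi : `|x 0 i| < (Num.truncn (\sum_i `|x 0 i|)).+1%:R.
  apply: (le_lt_trans _ (truncnS_gt _)).
  by rewrite (bigD1 i) //= lerDl sumr_ge0.
by move: xi; rewrite ltr_norml => /andP[-> /ltW].
Qed.

(** Made an instance below so that Tonelli's theorem applies to the product of the space with
    itself. *)
Lemma lebesgueRn_sigma_finite (R : realType) (n : nat) :
  sigma_finite [set: lebesgueRn_type R n] (@lebesgueRn R n).
Proof.
exists (fun k => box (const_mx (- k%:R), const_mx k%:R)).
  exact/esym/bigcup_centered_box.
by move=> k; split; [exact: measurable_box|exact: lebesgueRn_box_lty].
Qed.

HB.instance Definition _ (R : realType) (n : nat) :=
  Measure_isSigmaFinite.Build _ _ _ (@lebesgueRn R n)
    (@lebesgueRn_sigma_finite R n).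

Lemma lebesgue_outer_shift (R : realType) (n : nat) (v : 'rV[R]_n)
    (A : set 'rV[R]_n) :
  lebesgue_outer [set x | A (x - v)] = lebesgue_outer A.
Proof.
(* One inequality for all shifts is enough: the reverse one is the shift by [- v] of the translated
   set. *)
suff H (w : 'rV[R]_n) (B : set 'rV[R]_n) :
    (lebesgue_outer [set x | B (x - w)%R] <= lebesgue_outer B)%E.
  apply/eqP; rewrite eq_le H /=.
  rewrite [X in (lebesgue_outer X <= _)%E](_ : _ =
    [set x | [set x | A (x - v)%R] (x - - v)%R]).
    exact: H.
  by apply: eq_set => x /=; rewrite opprK addrK.
apply: le_ereal_inf_tmp => _ [F BF <-]; apply: ereal_inf_lbound.
exists (F.1, fun k => ((F.2 k).1 + w, (F.2 k).2 + w)).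
  move=> x /BF[k Fk xk]; exists k => // i; have := xk i.
  by rewrite /= !mxE ltrBrDr lerBlDr.
apply: eq_esum => k _; congr (_%:E); apply: eq_bigr => i _ /=.
by rewrite !mxE opprD addrACA subrr addr0.
Qed.

(** Rational corners make the union countable; boxes that leave [U] are replaced by [set0], so that
    the index type remains all pairs of rational vectors. *)
Lemma open_rat_boxes (R : realType) (n : nat) (U : set 'rV[R]_n) : open U ->
  U = \bigcup_(p : 'rV[rat]_n * 'rV[rat]_n)
        (if `[< box (map_mx ratr p.1, map_mx ratr p.2) `<=` U >]
         then box (map_mx ratr p.1, map_mx ratr p.2) else set0).
Proof.
move=> oU; apply/seteqP; split=> [x Ux|x [p _]]; last first.
  by case: asboolP => // pU; exact: pU.
have /nbhs_ballP[e /= e0 eU] := open_nbhs_nbhs (conj oU Ux).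
have [a Ha] : {a : 'I_n -> rat & forall i, ratr (a i) \in `]x 0 i - e, x 0 i[}.
  apply: (@choice _ _ (fun i q => ratr q \in `]x 0 i - e, x 0 i[)) => i.
  by apply: rat_in_itvoo; rewrite ltrBlDr ltrDl.
have [b Hb] : {a : 'I_n -> rat & forall i, ratr (a i) \in `]x 0 i, x 0 i + e[}.
  apply: (@choice _ _ (fun i q => ratr q \in `]x 0 i, x 0 i + e[)) => i.
  by apply: rat_in_itvoo; rewrite ltrDl.
exists (\row_i a i, \row_i b i) => //=.
case: asboolP => [_ i|]; rewrite /=.
  rewrite !mxE; move: (Ha i) (Hb i); rewrite !in_itv /=.
  by move=> /andP[_ ->] /andP[/ltW -> _].
case=> y yab; apply: eU; split => // i j.
have := yab j; rewrite !mxE ord1.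
move: (Ha j) (Hb j); rewrite !in_itv /= => /andP[h1 h2] /andP[h3 h4] /andP[h5 h6].
by rewrite /ball /= ltr_norml; apply/andP; split; lra.
Qed.

Lemma measurable_open (R : realType) (n : nat) (U : set 'rV[R]_n) :
  open U -> measurable (U : set (lebesgueRn_type R n)).
Proof.
move=> oU; rewrite (open_rat_boxes oU).
apply: countable_bigcupT_measurable; first exact: countableP.
move=> p; case: ifP => // _; exact: measurable_box.
Qed.

Lemma lebesgueRn_open_gt0 (R : realType) (n : nat) (U : set 'rV[R]_n) :
  open U -> U !=set0 -> (0 < @lebesgueRn R n setT)%E -> (0 < lebesgueRn U)%E.
Proof.
move=> oU [x Ux]; apply: contraTT; rewrite -!leNgt => U0.
have /nbhs_ballP[e /= e0 eU] := open_nbhs_nbhs (conj oU Ux).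
(* If U is null, so are its lattice translates e z, which cover the space. *)
pose A k := if @unpickle 'rV[int]_n k is Some z
  then [set y : 'rV[R]_n | U (y - e *: map_mx intr z)] else set0.
apply: (@le_trans _ _ (lebesgue_outer (\bigcup_k A k))).
  apply: le_outer_measure => y _.
  (* Rounding down puts each coordinate of [y - e z] in [x_i, x_i + e[, hence in the sup-norm ball
     around [x] that lies in [U]. *)
  pose z : 'rV[int]_n := \row_i Num.floor ((y 0 i - x 0 i) / e).
  exists (pickle z) => //; rewrite /A pickleK /=; apply: eU; split => // i j.
  rewrite /ball /= !mxE !ord1.
  have /andP[h1 h2] := real_floor_itv (num_real ((y 0 j - x 0 j) / e)).
  move: h1 h2; rewrite intrD; set f := _%:~R.
  rewrite ler_pdivlMr// ltr_pdivrMr// => h1 h2.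
  by rewrite ltr_norml; apply/andP; split; lra.
apply: (le_trans (outer_measure_sigma_subadditive _ A)).
rewrite eseries0 // => k _ _; rewrite /A.
case: unpickle => [z|]; last exact: outer_measure0.
apply/eqP; rewrite eq_le outer_measure_ge0 andbT; move: U0.
by rewrite /lebesgueRn -(lebesgue_outer_shift (e *: map_mx intr z) U).
Qed.

(** Testing the translated set on [X] amounts to testing [A] on [X] translated back. *)
Lemma measurable_shift (R : realType) (n : nat) (v : 'rV[R]_n)
    (A : set 'rV[R]_n) :
  measurable (A : set (lebesgueRn_type R n)) ->
  measurable ([set x | A (x - v)] : set (lebesgueRn_type R n)).
Proof.
move=> mA; have cA : (@lebesgue_outer R n).-caratheodory A := mA.
suff : (@lebesgue_outer R n).-caratheodory [set x | A (x - v)] by [].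
move=> X; have XE : X = [set x | X (x - v + v)].
  by apply: eq_set => x; rewrite subrK.
rewrite [in LHS]XE (lebesgue_outer_shift v [set x | X (x + v)]) cA.
rewrite -(lebesgue_outer_shift v ([set x | X (x + v)] `&` A)).
rewrite -(lebesgue_outer_shift v ([set x | X (x + v)] `&` ~` A)).
by congr (_ + _)%E; congr lebesgue_outer; apply: eq_set => x /=;
  rewrite subrK.
Qed.

(** All translates have the measure of [A], so every multiple of it is at most the finite measure of
    [B]. *)
Lemma lebesgueRn_null_of_disjoint_shifts (R : realType) (n : nat) (v : nat -> 'rV[R]_n)
    (A B : set 'rV[R]_n) :
  measurable (A : set (lebesgueRn_type R n)) ->
  measurable (B : set (lebesgueRn_type R n)) ->
  (lebesgueRn B < +oo)%E ->
  trivIset setT (fun k => [set x | A (x - v k)]) ->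
  (forall k, [set x | A (x - v k)] `<=` B) ->
  lebesgueRn A = 0%E.
Proof.
move=> mA mB Boo tA AB; pose S k : set (lebesgueRn_type R n) := [set x | A (x - v k)].
have mS k : measurable (S k) by exact: measurable_shift.
have SA k : lebesgueRn (S k) = lebesgueRn A by exact: lebesgue_outer_shift.
have AleB : (lebesgueRn A <= lebesgueRn B)%E.
  by rewrite -(SA 0%N); apply: le_outer_measure; exact: AB.
have sumB : (\sum_(k <oo) lebesgueRn (S k) <= lebesgueRn B)%E.
  have -> : (\sum_(k <oo) lebesgueRn (S k) = lebesgueRn (\bigcup_k S k))%E.
    by rewrite measure_bigcup//; apply: eq_eseriesl => k; rewrite in_setT.
  by apply: le_outer_measure => x [k _]; exact: AB.
have Afin : lebesgueRn A \is a fin_num by rewrite ge0_fin_numE ?(le_lt_trans AleB).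
have Bfin : lebesgueRn B \is a fin_num by rewrite ge0_fin_numE.
have MA (M : nat) : fine (lebesgueRn A) *+ M <= fine (lebesgueRn B).
  rewrite -lee_fin fineK // (le_trans _ sumB)//.
  rewrite (le_trans _ (nneseries_lim_ge M _))//.
  rewrite (eq_bigr (fun=> (fine (lebesgueRn A))%:E)) => [|k _]; last first.
    by rewrite SA fineK.
  by rewrite sumEFin big_mkord sumr_const card_ord.
apply/eqP; rewrite eq_le measure_ge0 andbT -(fineK Afin) lee_fin leNgt.
apply/negP => A0.
(* With this number of copies the total would exceed the measure of [B]. *)
have := MA (Num.truncn (fine (lebesgueRn B) / fine (lebesgueRn A))).+1.
by rewrite leNgt -mulr_natr -ltr_pdivrMl// mulrC truncnS_gt.
Qed.

(** As [p != 0] and [i != j], a shift along e_j changes the left-hand side of the equation, so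
    distinct shifts of the hyperplane are disjoint. *)
Lemma lebesgueRn_hyperplane (R : realType) (n : nat) (i j : 'I_n) (p q b : R) :
  i != j -> p != 0 ->
  lebesgueRn [set y : 'rV[R]_n | y 0 j * p - y 0 i * q = b] = 0%E.
Proof.
move=> ij p0; set N := [set y | _].
have mN : measurable (N : set (lebesgueRn_type R n)).
  rewrite (_ : N = (fun y : lebesgueRn_type R n =>
    (y : 'rV[R]_n) 0 j * p - (y : 'rV[R]_n) 0 i * q) @^-1` [set b]) //.
  rewrite -[X in measurable X]setTI.
  have mf : measurable_fun setT (fun y : lebesgueRn_type R n =>
      (y : 'rV[R]_n) 0 j * p - (y : 'rV[R]_n) 0 i * q).
    apply: measurable_funB; apply: measurable_funM.
    - exact: measurable_coord.
    - exact: measurable_cst.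
    - exact: measurable_coord.
    - exact: measurable_cst.
  exact: mf.
(* The translates of N `&` B k by e_j / (m + 1), for m : nat, are pairwise
   disjoint subsets of B (k + 1). *)
pose B k := box (const_mx (- k%:R), const_mx k%:R) : set 'rV[R]_n.
pose v k : 'rV[R]_n := k.+1%:R^-1 *: delta_mx 0 j.
have xvE (x : 'rV[R]_n) k l : (x - v k) 0 l = x 0 l - v k 0 l.
  by move: (v k) => w; rewrite !mxE.
have vj k : v k 0 j = k.+1%:R^-1 by rewrite !mxE !eqxx mulr1.
have vi k l : l != j -> v k 0 l = 0.
  by move=> lj; rewrite !mxE (negbTE lj) andbF mulr0.
have v1 k l : 0 <= v k 0 l <= 1.
  have [->|lj] := eqVneq l j; last by rewrite vi// lexx ler01.
  by rewrite vj invr_ge0 ler0n /= invf_le1 ?ltr0Sn// ler1n.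
apply/eqP; rewrite eq_le measure_ge0 andbT.
have -> : N = \bigcup_k (N `&` B k).
  by rewrite -setI_bigcupr bigcup_centered_box setIT.
apply: (le_trans (outer_measure_sigma_subadditive (@lebesgue_outer R n)
  (fun k => N `&` B k))).
rewrite eseries0// => k _ _.
apply: (@lebesgueRn_null_of_disjoint_shifts R n v _ (B k.+1)).
- apply: measurableI => //; exact: measurable_box.
- exact: measurable_box.
- exact: lebesgueRn_box_lty.
- move=> k1 k2 _ _ [x [[h1 _] [h2 _]]].
  move: h1 h2; rewrite /N /= !xvE !vj !vi//.
  rewrite !subr0.
  move=> h1; rewrite -h1 => /addIr/(mulIf p0)/addrI/oppr_inj/invr_inj/eqP.
  by rewrite eqr_nat => /eqP[].
- move=> m x [_ xB] l; have := v1 m l; have := xB l; move: (v m) => w.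
  by rewrite /= !mxE -natr1 => /andP[? ?] /andP[? ?]; apply/andP; split; lra.
Qed.

(** * Finiteness and positivity of Gamma *)

(** The primitive is t^s / s. The bound does not depend on [a], which allows [a] to tend to 0
    next. *)
Lemma integral_powR_itv (R : realType) (s a : R) : 0 < s -> 0 < a < 1 ->
  (\int[lebesgue_measure]_(t in `[a, 1%R]) (t `^ (s - 1))%:E <= (s^-1)%:E)%E.
Proof.
move=> s0 /andP[a0 a1].
have dF (x : R) : 0 < x -> is_derive x 1 (fun t : R => s^-1 * t `^ s : R) (x `^ (s - 1)).
  move=> x0; rewrite -[X in is_derive _ _ _ X](mulKf (lt0r_neq0 s0)).
  exact: (is_deriveZ s^-1 (is_derive1_powR s x0)).
have cF (x : R) : 0 < x -> {for x, continuous (fun t : R => s^-1 * t `^ s : R)}.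
  by move=> x0; apply/differentiable_continuous/derivable1_diffP; have [] := dF x x0.
rewrite (@continuous_FTC2 _ _ (fun t => s^-1 * t `^ s)) //.
- rewrite powR1 mulr1 -EFinB lee_fin gerBl.
  by rewrite mulr_ge0 ?powR_ge0// invr_ge0 ltW.
- apply: derivable_within_continuous => x; rewrite in_itv /= => /andP[ax _].
  by apply: derivable_powR; rewrite in_itv /= andbT (lt_le_trans a0).
- split.
  + by move=> x; rewrite in_itv /= => /andP[ax _]; have [] := dF x (lt_trans a0 ax).
  + exact/cvg_at_right_filter/cF.
  + exact/cvg_at_left_filter/cF.
- move=> x; rewrite in_itv /= => /andP[ax _]; rewrite derive1E.
  by have [_ ->] := dF x (lt_trans a0 ax).
Qed.

Lemma integral_powR01 (R : realType) (s : R) : 0 < s ->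
  (\int[lebesgue_measure]_(t in `]0%R, 1%R]) (t `^ (s - 1))%:E <= (s^-1)%:E)%E.
Proof.
(* Starting at 1/2 keeps the left end strictly below 1, as [integral_powR_itv] requires. *)
move=> s0; pose F (k : nat) : set R := `[k.+2%:R^-1, 1]%classic.
have -> : `]0%R, 1%R]%classic = \bigcup_k F k.
  apply/seteqP; split=> [x|x [k _]] /=; rewrite /F /= !in_itv /= => /andP[x0 x1].
    exists (Num.truncn x^-1) => //=; rewrite in_itv /= x1 andbT invf_ple ?posrE//.
    by rewrite ltW// (lt_trans (truncnS_gt _))// ltr_nat.
  by rewrite x1 (lt_le_trans _ x0) ?invr_gt0.
have mf : measurable_fun [set: R] (fun t : R => (t `^ (s - 1))%:E).
  by apply/measurable_EFinP; exact: measurable_powR.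
have cvF : (\int[lebesgue_measure]_(x in F i) (x `^ (s - 1))%:E)%E @[i --> \oo]
    --> (\int[lebesgue_measure]_(x in \bigcup_i F i) (x `^ (s - 1))%:E)%E.
  apply: ge0_nondecreasing_set_cvg_integral.
  - move=> k l kl; apply/subsetPset => x; rewrite /F /= !in_itv /= => /andP[x0 ->].
    rewrite andbT (le_trans _ x0)// lef_pV2 ?posrE//.
    by rewrite ler_nat !ltnS.
  - by move=> k; exact: measurable_itv.
  - by move=> k; apply: measurable_funTS.
  - by move=> k x _; rewrite lee_fin powR_ge0.
rewrite -(cvg_lim _ cvF)//; apply: lime_le; first by apply/cvg_ex; eexists; exact: cvF.
apply: nearW => k; apply: integral_powR_itv => //.
by rewrite invr_gt0 ltr0n invf_lt1 ?ltr0n// ltr1n.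
Qed.

(** The tail is compared with a probability density. Of the two factors exp(-t/2) of exp(-t), one
    absorbs the power, since (t/2)^N <= N! exp(t/2), and the other is the density of rate 1/2 up to
    its factor 1/2, whence the exponent [N.+1] in the constant. *)
Lemma powR_expRN_le (R : realType) (s : R) :
  exists2 C : R, 0 <= C & forall t, 1 <= t ->
    t `^ (s - 1) * expR (- t) <= C * exponential_pdf (2^-1) t.
Proof.
pose N := (Num.truncn `|s - 1|).+1.
exists (N`!%:R * 2 ^+ N.+1) => [|t t1]; first by rewrite mulr_ge0// exprn_ge0.
have t0 : 0 <= t by rewrite (le_trans _ t1).
rewrite /exponential_pdf patchE mem_set; last by rewrite /= in_itv /= andbT.
have tN : t `^ (s - 1) <= t ^+ N.
  rewrite -powR_mulrn//; apply: ler_powR => //.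
  by rewrite (le_trans (ler_norm _))// ltW// truncnS_gt.
have eN : (t / 2) ^+ N <= N`!%:R * expR (t / 2).
  rewrite [leRHS]mulrC -ler_pdivrMr ?ltr0n ?fact_gt0//.
  have t2 : 0 <= t / 2 by rewrite divr_ge0.
  by apply: le_trans (expR_ge1Dxn (Num.truncn `|s - 1|) t2); rewrite lerDr.
have -> : expR (- t) = expR (- 2^-1 * t) * expR (- 2^-1 * t).
  by rewrite -expRD; congr expR; lra.
rewrite mulrA [X in _ <= X](_ : _ = N`!%:R * 2 ^+ N * expR (- 2^-1 * t)); last first.
  by rewrite exprSr; move: (2 ^+ N) (expR _) (N`!%:R) => a b c; lra.
rewrite ler_wpM2r ?expR_ge0// (le_trans (ler_wpM2r _ tN)) ?expR_ge0//.
rewrite mulNr expRN ler_pdivrMr ?expR_gt0// [2^-1 * t]mulrC.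
rewrite [_ * _ * expR _]mulrAC -ler_pdivrMr ?exprn_gt0//.
by rewrite -exprVn -exprMn.
Qed.

(** [fine] sends an infinite integral to 0, so both a positive lower bound, from [1, 2], and a
    finite upper bound, from a splitting at 1, are needed. *)
Lemma Gamma_gt0 (R : realType) (s : R) : 0 < s -> 0 < Gamma s.
Proof.
move=> s0; pose G (t : R) := t `^ (s - 1) * expR (- t).
have G0 t : 0 <= G t by rewrite mulr_ge0 ?powR_ge0 ?expR_ge0.
have mG : measurable_fun [set: R] (fun t => (G t)%:E).
  apply/measurable_EFinP; apply: measurable_funM; first exact: measurable_powR.
  by apply: measurableT_comp; [exact: measurable_expR|exact: oppr_measurable].
have -> : Gamma s = fine (\int[lebesgue_measure]_(t in `]0%R, +oo[) (G t)%:E)%E by [].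
apply: fine_gt0; apply/andP; split.
(* On [1, 2], t^(s - 1) >= t^(-1) >= 1/2 because s > 0, and exp(-t) >= exp(-2). *)
- pose c : R := 2^-1 * expR (-2).
  have c0 : 0 < c by rewrite mulr_gt0 ?expR_gt0.
  apply: (@lt_le_trans _ _ (\int[lebesgue_measure]_(t in `[1%R, 2%R]) (c)%:E)%E).
    rewrite integral_cst//= lebesgue_measure_itv/= lte_fin ltr1n -EFinB.
    by rewrite -EFinM lte_fin mulr_gt0//; lra.
  apply: (@le_trans _ _ (\int[lebesgue_measure]_(t in `[1%R, 2%R]) (G t)%:E)%E).
    apply: ge0_le_integral => //.
    - by move=> t _; rewrite lee_fin ltW.
    - exact: measurable_funTS.
    - move=> t /=; rewrite in_itv /= => /andP[t1 t2]; rewrite lee_fin /c /G.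
      apply: ler_pM; rewrite ?expR_ge0//; last by rewrite ler_expR; lra.
      apply: (@le_trans _ _ (t `^ (-1))).
        by rewrite powR_inv1 ?lef_pV2 ?posrE//; lra.
      by apply: ler_powR => //; lra.
  apply: ge0_subset_integral => //.
  + exact: measurable_funTS.
  + by move=> t; rewrite lee_fin.
  + by move=> t /=; rewrite !in_itv /= andbT => /andP[t1 _]; lra.
- rewrite (_ : `]0%R, +oo[%classic = `]0%R, 1%R] `|` `]1%R, +oo[); last first.
    apply/seteqP; split=> t /=; rewrite !in_itv /= !andbT.
      by move=> ->; case: leP => _; [left|right].
    by case=> [/andP[]//|]; apply: lt_trans.
  rewrite ge0_integral_setU//=; last 3 first.
  + exact: measurable_funTS.
  + by move=> t _; rewrite lee_fin.
  + apply/disj_setPS => t /=; rewrite !in_itv /= andbT => -[/andP[_ t1]].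
    by rewrite ltNge t1.
  apply: lte_add_pinfty.
    apply: (@le_lt_trans _ _
      (\int[lebesgue_measure]_(t in `]0%R, 1%R]) (t `^ (s - 1))%:E)%E).
      apply: ge0_le_integral => //.
      - by move=> t _; rewrite lee_fin.
      - exact: measurable_funTS.
      - by apply: measurable_funTS; apply/measurable_EFinP; exact: measurable_powR.
      - move=> t /=; rewrite in_itv /= => /andP[t0 _]; rewrite lee_fin.
        by rewrite ler_piMr ?powR_ge0// -expR0 ler_expR; lra.
    exact: (le_lt_trans (integral_powR01 s0) (ltry _)).
  have [C C0 HC] := powR_expRN_le s.
  have h2 : 0 < 2^-1 :> R by [].
  have me : measurable_fun [set: R] (fun t => (exponential_pdf 2^-1 t)%:E).
    by apply/measurable_EFinP; exact: measurable_exponential_pdf.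
  have e0 (t : R) : 0 <= exponential_pdf 2^-1 t by exact/exponential_pdf_ge0/ltW.
  apply: (@le_lt_trans _ _ (\int[lebesgue_measure]_(t in `]1%R, +oo[)
    (C%:E * (exponential_pdf 2^-1 t)%:E))%E).
    apply: ge0_le_integral => //.
    - by move=> t _; rewrite lee_fin.
    - exact: measurable_funTS.
    - by apply: measurable_funTS; exact: measurable_funeM.
    - by move=> t /=; rewrite in_itv /= andbT => /ltW/HC.
  apply: (@le_lt_trans _ _
    (\int[lebesgue_measure]_t (C%:E * (exponential_pdf 2^-1 t)%:E))%E).
    apply: ge0_subset_integral => //; first exact: measurable_funeM.
    by move=> t _; rewrite mule_ge0// lee_fin.
  rewrite ge0_integralZl ?lee_fin//; last by move=> t _; rewrite lee_fin.
  by rewrite integral_exponential_pdf// mule1 ltry.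
Qed.

Lemma mu_const_gt0 (R : realType) (n : nat) (alpha : R) : 0 < alpha < 1 ->
  0 < mu_const n alpha.
Proof.
move=> /andP[a0 a1]; rewrite /mu_const divr_gt0 ?mulr_gt0 ?powR_gt0 ?pi_gt0//.
  by apply: Gamma_gt0; rewrite divr_gt0// addr_gt0// ltr_wpDl.
by apply: Gamma_gt0; rewrite divr_gt0// subr_gt0.
Qed.

(** * The norm of a vector-valued integral *)

Lemma enorm_ge0 (R : realType) (n : nat) (x : 'rV[R]_n) : 0 <= enorm x.
Proof. exact: sqrtr_ge0. Qed.

Lemma sqr_enorm (R : realType) (n : nat) (x : 'rV[R]_n) :
  enorm x ^+ 2 = \sum_i x 0 i ^+ 2.
Proof. by rewrite sqr_sqrtr// sumr_ge0// => i _; exact: sqr_ge0. Qed.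

Lemma enorm_eq0 (R : realType) (n : nat) (x : 'rV[R]_n) : enorm x = 0 -> x = 0.
Proof.
move=> x0; apply/rowP => i; rewrite mxE; apply/eqP; rewrite -sqrf_eq0.
have /eqP := sqr_enorm x; rewrite x0 expr0n eq_sym psumr_eq0 => [|? _]; last first.
  exact: sqr_ge0.
by move=> /allP/(_ i (mem_index_enum i)).
Qed.

Lemma enormZ (R : realType) (n : nat) (a : R) (x : 'rV[R]_n) :
  enorm (a *: x) = `|a| * enorm x.
Proof.
rewrite -sqrtr_sqr -sqrtrM ?sqr_ge0// mulr_sumr; congr Num.sqrt.
by apply: eq_bigr => i _; rewrite mxE exprMn.
Qed.

Lemma ler_coord_enorm (R : realType) (n : nat) (x : 'rV[R]_n) (i : 'I_n) :
  `|x 0 i| <= enorm x.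
Proof.
rewrite -sqrtr_sqr ler_sqrt ?sumr_ge0// => [|j _]; last exact: sqr_ge0.
by rewrite (bigD1 i)//= lerDl sumr_ge0// => j _; exact: sqr_ge0.
Qed.

(** The Cauchy-Schwarz inequality and its equality case both follow: the left-hand side is a square,
    and it vanishes only when the two vectors have the same direction or one of them is zero. *)
Lemma enorm_lagrange (R : realType) (n : nat) (a b : 'rV[R]_n) :
  enorm (enorm b *: a - enorm a *: b) ^+ 2 =
  2 * (enorm a * enorm b) * (enorm a * enorm b - \sum_i a 0 i * b 0 i).
Proof.
rewrite sqr_enorm (eq_bigr (fun i => enorm b ^+ 2 * a 0 i ^+ 2 +
  (enorm a ^+ 2 * b 0 i ^+ 2 - 2 * (enorm a * enorm b) * (a 0 i * b 0 i)))); last first.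
  move=> i _; rewrite !mxE; move: (enorm a) (enorm b) (a 0 i) (b 0 i) => p q r s.
  by ring.
rewrite big_split sumrB /= -!mulr_sumr -!sqr_enorm.
by move: (enorm a) (enorm b) (\sum_i _) => p q r; ring.
Qed.

Lemma cauchy_schwarz (R : realType) (n : nat) (a b : 'rV[R]_n) :
  \sum_i a 0 i * b 0 i <= enorm a * enorm b.
Proof.
have [a0|a0] := eqVneq (enorm a) 0.
  by rewrite a0 mul0r big1// => i _; rewrite (enorm_eq0 a0) mxE mul0r.
have [b0|b0] := eqVneq (enorm b) 0.
  by rewrite b0 mulr0 big1// => i _; rewrite (enorm_eq0 b0) mxE mulr0.
have ab0 : 0 < 2 * (enorm a * enorm b).
  by rewrite !mulr_gt0// lt0r enorm_ge0 ?a0 ?b0.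
by rewrite -subr_ge0 -(pmulr_rge0 _ ab0) -enorm_lagrange sqr_ge0.
Qed.

Lemma cauchy_schwarz_eq (R : realType) (n : nat) (a b : 'rV[R]_n) :
  \sum_i a 0 i * b 0 i = enorm a * enorm b -> enorm b *: a = enorm a *: b.
Proof.
move=> ab; apply/eqP; rewrite -subr_eq0; apply/eqP/enorm_eq0/eqP.
by rewrite -sqrf_eq0 enorm_lagrange ab subrr mulr0.
Qed.

Section integral_lemmas.
Context d (T : measurableType d) (R : realType).
Variable mu : {measure set T -> \bar R}.

(** The difference has integral 0 and is nonnegative a.e.; finiteness of the integral of [g] permits
    the subtraction. The absolute value makes the difference nonnegative everywhere, as additivity
    of nonnegative integrals demands. *)
Lemma ge0_integral_eq_ae (D : set T) (f : T -> R) (g : T -> \bar R) :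
  measurable D -> measurable_fun D f -> measurable_fun D g ->
  (forall x, 0 <= f x) -> (forall x, 0 <= g x)%E ->
  {ae mu, forall x, D x -> ((f x)%:E <= g x)%E} ->
  (\int[mu]_(x in D) g x < +oo)%E ->
  (\int[mu]_(x in D) (f x)%:E)%E = (\int[mu]_(x in D) g x)%E ->
  {ae mu, forall x, D x -> (f x)%:E = g x}.
Proof.
move=> mD mf mg f0 g0 fg goo fgE.
have mf' : measurable_fun D (EFin \o f) by apply/measurable_EFinP.
have mgf : measurable_fun D (fun x => g x - (f x)%:E)%E.
  exact: emeasurable_funB.
have mabs : measurable_fun D (fun x => `|g x - (f x)%:E|)%E.
  by apply: measurableT_comp => //; exact: mgf.
have gE : (\int[mu]_(x in D) g x =
    \int[mu]_(x in D) (f x)%:E + \int[mu]_(x in D) `|g x - (f x)%:E|)%E.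
  rewrite -ge0_integralD//; last by move=> x _; rewrite lee_fin.
  apply: ge0_ae_eq_integral => //.
  - exact: (emeasurable_funD mf' mabs).
  - by move=> x _; rewrite adde_ge0// lee_fin.
  - apply: filterS fg => x + Dx; move/(_ Dx) => fgx.
    by rewrite gee0_abs ?sube_ge0// addeC subeK.
have ffin : (\int[mu]_(x in D) (f x)%:E)%E \is a fin_num.
  by rewrite fgE ge0_fin_numE// integral_ge0.
have abs0 : (\int[mu]_(x in D) `|g x - (f x)%:E| = 0)%E.
  move/eqP: gE; rewrite -fgE addeC -sube_eq ?fin_num_adde_defl//.
  by rewrite subee// => /eqP.
have /(ae_eq_integral_abs mu mD mgf) abs0' := abs0.
apply: filterS abs0' => x + Dx => /(_ Dx) /=.
case: (g x) => [r||]// /eqP; rewrite -EFinB eqe subr_eq0.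
by move=> /eqP ->.
Qed.

Variables (n : nat) (g : 'I_n -> T -> R) (k : T -> R).
Hypothesis gk : forall y, enorm (\row_i g i y) = k y.
Hypothesis ki : mu.-integrable setT (EFin \o k).
Hypothesis mg : forall i, measurable_fun setT (g i).

Let G : 'rV[R]_n := \row_i \int[mu]_y g i y.

Let k0 y : 0 <= k y. Proof. by rewrite -gk enorm_ge0. Qed.

Lemma integrable_enorm_coord i : mu.-integrable setT (EFin \o g i).
Proof.
apply: (le_integrable measurableT _ _ ki); first exact/measurable_EFinP.
move=> y _; rewrite lee_fin [leRHS]ger0_norm// -gk.
by rewrite (le_trans _ (ler_coord_enorm _ i))// mxE.
Qed.

Let gi := integrable_enorm_coord.

Let kfin : (\int[mu]_y (k y)%:E)%E \is a fin_num.
Proof. exact: integrable_fin_num ki. Qed.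

Let di : mu.-integrable setT (fun y => \sum_i (G 0 i * g i y)%:E)%E.
Proof.
apply: integrable_sum => // i _; exact: (integrableZl measurableT (G 0 i) (gi i)).
Qed.

Let intd : (\int[mu]_y (\sum_i (G 0 i * g i y)%:E) = (enorm G ^+ 2)%:E)%E.
Proof.
rewrite integral_sum//; last first.
  move=> i; exact: (integrableZl measurableT (G 0 i) (gi i)).
rewrite sqr_enorm -sumEFin; apply: eq_bigr => i _.
under eq_integral do rewrite EFinM.
rewrite integralZl//; last exact: gi.
by rewrite {2}/G mxE /Rintegral expr2 EFinM fineK// integrable_fin_num//; exact: gi.
Qed.

Let kGi : mu.-integrable setT (fun y => (enorm G)%:E * (k y)%:E)%E.
Proof. exact: (integrableZl measurableT). Qed.

Let dk y : (\sum_i (G 0 i * g i y)%:E <= (enorm G)%:E * (k y)%:E)%E.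
Proof.
rewrite sumEFin -EFinM lee_fin -gk (le_trans _ (cauchy_schwarz _ _))//.
by under [leRHS]eq_bigr do rewrite [(\row_ _ _) _ _]mxE.
Qed.

(** By linearity |G|^2 is the integral of <G, g>, which is at most |G| times the integral of [k] by
    Cauchy-Schwarz; then |G| is cancelled if nonzero. *)
Lemma enorm_integral_le : enorm G <= \int[mu]_y k y.
Proof.
have [->|G0] := eqVneq (enorm G) 0.
  by apply: fine_ge0; apply: integral_ge0 => y _; rewrite lee_fin.
have Gp : 0 < enorm G by rewrite lt0r G0 enorm_ge0.
rewrite -(ler_pM2l Gp) -lee_fin -expr2 -intd [leRHS]EFinM /Rintegral fineK//.
by rewrite -integralZl//; apply: le_integral => // y _; exact: dk.
Qed.

(** Equality gives integral 0 to the nonnegative function |G| k - <G, g>, so Cauchy-Schwarz is an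
    equality at a.e. [y]. Without division the conclusion also makes sense for G = 0. *)
Lemma enorm_integral_eq : enorm G = \int[mu]_y k y ->
  {ae mu, forall y i, k y * G 0 i = enorm G * g i y}.
Proof.
move=> GE.
have h : (\int[mu]_y `|(enorm G)%:E * (k y)%:E - \sum_i (G 0 i * g i y)%:E| = 0)%E.
  have -> : (fun y => `|(enorm G)%:E * (k y)%:E - \sum_i (G 0 i * g i y)%:E|)%E =
      (fun y => (enorm G)%:E * (k y)%:E - \sum_i (G 0 i * g i y)%:E)%E.
    apply/funext => y; rewrite gee0_abs// sube_ge0 ?dk//.
    by rewrite sumEFin.
  rewrite integralB// intd integralZl// expr2 EFinM.
  have -> : (\int[mu]_y (k y)%:E = (enorm G)%:E)%E by rewrite GE /Rintegral fineK.
  by rewrite subee.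
have mh : measurable_fun setT
    (fun y => (enorm G)%:E * (k y)%:E - \sum_i (G 0 i * g i y)%:E)%E.
  exact: measurable_int (integrableB measurableT kGi di).
have /(ae_eq_integral_abs mu measurableT mh) h0 := h.
apply: filterS h0 => y /(_ I) /eqP.
rewrite sumEFin -EFinM -EFinB eqe subr_eq0 => /eqP kE i.
have /cauchy_schwarz_eq/rowP/(_ i) : \sum_i G 0 i * (\row_i g i y) 0 i =
    enorm G * enorm (\row_i g i y).
  by rewrite gk kE; apply: eq_bigr => j _; rewrite [(\row__ _) _ _]mxE.
by rewrite gk !mxE.
Qed.

End integral_lemmas.

(** * The fractional kernel *)

Definition frac_coord (R : realType) (n : nat) (alpha : R) (E : set 'rV[R]_n)
    (i : 'I_n) (x y : 'rV[R]_n) : R :=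
  (y - x) 0 i * (\1_E y - \1_E x) / enorm (y - x) `^ (n%:R + alpha + 1).

Lemma enorm_frac_coord (R : realType) (n : nat) (alpha : R) (E : set 'rV[R]_n)
    (x y : 'rV[R]_n) : 0 < alpha ->
  enorm (\row_i frac_coord alpha E i x y) = frac_kernel alpha E x y.
Proof.
move=> a0; rewrite /frac_kernel.
have r0 : 0 < n%:R + alpha by rewrite ltr_wpDl.
set e := enorm (y - x); set D := \1_E y - \1_E x.
have -> : \row_i frac_coord alpha E i x y = (D / e `^ (n%:R + alpha + 1)) *: (y - x).
  by apply/rowP => i; rewrite mxE /frac_coord [RHS]mxE -/e -/D [_ * D]mulrC mulrAC.
rewrite enormZ normrM normfV [`|_ `^ _|]ger0_norm ?powR_ge0// -mulrA; congr (_ * _).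
(* On the diagonal both sides are 0: the exponent [n%:R + alpha] is nonzero, so the power of 0 is 0,
   and its inverse is 0 by convention. *)
rewrite -/e; have [->|e0] := eqVneq e 0.
  by rewrite mulr0 powR0 ?gt_eqF// invr0.
rewrite powRD; last by rewrite e0 implybT.
by rewrite powRr1 ?enorm_ge0// invfM -mulrA mulVf// mulr1.
Qed.

Lemma frac_kernel_ge0 (R : realType) (n : nat) (alpha : R) (E : set 'rV[R]_n)
    (x y : 'rV[R]_n) : 0 <= frac_kernel alpha E x y.
Proof. by rewrite divr_ge0// powR_ge0. Qed.

Lemma frac_kernel_eq0 (R : realType) (n : nat) (alpha : R) (E : set 'rV[R]_n)
    (x y : 'rV[R]_n) : frac_kernel alpha E x y = 0 -> \1_E y = \1_E x :> R.
Proof.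
move=> /eqP; rewrite mulf_eq0 normr_eq0 subr_eq0 invr_eq0 powR_eq0.
move=> /orP[/eqP//|/andP[/eqP/enorm_eq0/eqP]]; rewrite subr_eq0 => /eqP -> //.
Qed.

Section kernel_measurability.
Context (R : realType) (n : nat) (alpha : R) (E : set 'rV[R]_n).
Hypothesis mE : measurable (E : set (lebesgueRn_type R n)).

Let T := lebesgueRn_type R n.

Let m_coord (i : 'I_n) :
  measurable_fun setT (fun z : T * T => ((z.2 : 'rV[R]_n) - z.1) 0 i).
Proof.
have -> : (fun z : T * T => ((z.2 : 'rV[R]_n) - z.1) 0 i) =
    (fun z : T * T => (z.2 : 'rV[R]_n) 0 i - (z.1 : 'rV[R]_n) 0 i).
  by apply/funext => z; rewrite !mxE.
apply: measurable_funB.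
- exact: (measurableT_comp (measurable_coord i) measurable_snd).
- exact: (measurableT_comp (measurable_coord i) measurable_fst).
Qed.

Let m_powR (r : R) : measurable_fun setT
  (fun z : T * T => (enorm ((z.2 : 'rV[R]_n) - z.1) `^ r)^-1).
Proof.
(* Root and inverse become powers, so that measurability of [powR] handles both. *)
have -> : (fun z : T * T => (enorm ((z.2 : 'rV[R]_n) - z.1) `^ r)^-1) =
    (fun z : T * T => ((\sum_i ((z.2 : 'rV[R]_n) - z.1) 0 i ^+ 2) `^ 2^-1) `^ - r).
  apply/funext => z; rewrite powRN powR12_sqrt// sumr_ge0// => i _.
  exact: sqr_ge0.
have ms : measurable_fun setT
    (fun z : T * T => \sum_i ((z.2 : 'rV[R]_n) - z.1) 0 i ^+ 2).
  by apply: measurable_sum => i; apply: measurable_funX; exact: m_coord.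
have mh := measurableT_comp (@measurable_powR R 2^-1) ms.
exact: (measurableT_comp (@measurable_powR R (- r)) mh).
Qed.

Let m_jump : measurable_fun setT
  (fun z : T * T => \1_E (z.2 : 'rV[R]_n) - \1_E (z.1 : 'rV[R]_n) : R).
Proof.
have mi : measurable_fun setT (\1_E : T -> R) by exact: measurable_indic.
apply: measurable_funB.
- exact: (measurableT_comp mi measurable_snd).
- exact: (measurableT_comp mi measurable_fst).
Qed.

Lemma measurable_frac_kernel : measurable_fun setT
  (fun z : T * T => frac_kernel alpha E (z.1 : 'rV[R]_n) (z.2 : 'rV[R]_n)).
Proof.
apply: measurable_funM; last exact: m_powR.
have mn := @normr_measurable R setT.
exact (measurableT_comp mn m_jump).
Qed.

Lemma measurable_frac_coord (i : 'I_n) : measurable_fun setT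
  (fun z : T * T => frac_coord alpha E i (z.1 : 'rV[R]_n) (z.2 : 'rV[R]_n)).
Proof.
apply: measurable_funM; last exact: m_powR.
by apply: measurable_funM; [exact: m_coord|exact: m_jump].
Qed.

(** Extended-real, as finiteness will be known only for a.e. x in [Omega]. *)
Definition kernel_mass (x : T) : \bar R :=
  (\int[lebesgueRn]_y (frac_kernel alpha E (x : 'rV[R]_n) (y : 'rV[R]_n))%:E)%E.

Lemma kernel_mass_ge0 x : (0 <= kernel_mass x)%E.
Proof. by apply: integral_ge0 => y _; rewrite lee_fin frac_kernel_ge0. Qed.

Lemma measurable_kernel_mass : measurable_fun setT kernel_mass.
Proof.
apply: (measurable_fun_fubini_tonelli_F
  (fun z : T * T => (frac_kernel alpha E (z.1 : 'rV[R]_n) (z.2 : 'rV[R]_n))%:E)).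
  apply/measurable_EFinP; exact: measurable_frac_kernel.
by move=> z; rewrite lee_fin frac_kernel_ge0.
Qed.

(** The integrand changes sign, so Tonelli is applied to its positive and negative parts; [fine] of
    the difference is measurable even across points where the integral diverges. *)
Lemma measurable_integral_frac_coord (i : 'I_n) : measurable_fun setT
  (fun x : T => \int[lebesgueRn]_y
     (frac_coord alpha E i (x : 'rV[R]_n) (y : 'rV[R]_n))).
Proof.
pose f := fun z : T * T => (frac_coord alpha E i (z.1 : 'rV[R]_n) (z.2 : 'rV[R]_n))%:E.
have mf : measurable_fun setT f.
  apply/measurable_EFinP; exact: measurable_frac_coord.
apply: measurableT_comp; first exact: fine_measurable.
have -> : (fun x : T => (\int[lebesgueRn]_y
     (frac_coord alpha E i (x : 'rV[R]_n) (y : 'rV[R]_n))%:E)%E) =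
   (fun x => fubini_F (@lebesgueRn R n) f^\+ x - fubini_F (@lebesgueRn R n) f^\- x)%E.
  apply/funext => x; rewrite integralE.
  by congr (_ - _)%E; apply: eq_integral => y _; rewrite ?funeposE ?funenegE.
apply: emeasurable_funB.
- apply: measurable_fun_fubini_tonelli_F => //; exact: measurable_funepos.
- apply: measurable_fun_fubini_tonelli_F => //; exact: measurable_funeneg.
Qed.

Lemma measurable_enorm_frac_gradient :
  measurable_fun setT (fun x : T => enorm (frac_gradient alpha E (x : 'rV[R]_n))).
Proof.
pose I (x : T) (i : 'I_n) := \int[lebesgueRn]_y
     (frac_coord alpha E i (x : 'rV[R]_n) (y : 'rV[R]_n)).
have -> : (fun x : T => enorm (frac_gradient alpha E (x : 'rV[R]_n))) =
    (fun x : T => (\sum_i (mu_const n alpha * I x i) ^+ 2) `^ 2^-1).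
  apply/funext => x; rewrite powR12_sqrt; last first.
    by rewrite sumr_ge0// => i _; exact: sqr_ge0.
  by congr Num.sqrt; apply: eq_bigr => i _; rewrite !mxE.
have ms : measurable_fun setT (fun x : T => \sum_i (mu_const n alpha * I x i) ^+ 2).
  apply: measurable_sum => i; apply: measurable_funX; apply: measurable_funM.
  - exact: measurable_cst.
  - exact: measurable_integral_frac_coord.
exact: (measurableT_comp (@measurable_powR R 2^-1) ms).
Qed.

(** In both terms x ranges over [Omega], while y ranges over [Omega] and then its complement; the
    sum is one double integral over [Omega] times the whole space. *)
Lemma frac_perimeterE (Omega : set 'rV[R]_n) :
  measurable (Omega : set T) ->
  frac_perimeter alpha E Omega = (\int[lebesgueRn]_(x in Omega) kernel_mass x)%E.
Proof.
move=> mO.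
pose f := (fun z : T * T => (frac_kernel alpha E (z.1 : 'rV[R]_n) (z.2 : 'rV[R]_n))%:E)
  \_ ((Omega : set T) `*` [set: T]).
have mf : measurable_fun setT f.
  apply/(measurable_restrictT _ (measurableX mO measurableT)).
  apply: measurable_funTS; apply/measurable_EFinP; exact: measurable_frac_kernel.
have f0 z : (0 <= f z)%E.
  by apply: erestrict_ge0 => w _; rewrite lee_fin frac_kernel_ge0.
have fE (x y : T) : f (x, y) =
    ((fun x : T => (frac_kernel alpha E (x : 'rV[R]_n) y)%:E) \_ Omega) x.
  by rewrite /f !patchE; congr (if _ then _ else _); apply/idP/idP;
    rewrite !inE => //= -[].
have GE (y : T) : (\int[lebesgueRn]_(x in Omega) (frac_kernel alpha E x y)%:E)%E =
    fubini_G (@lebesgueRn R n) f y.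
  by rewrite integral_mkcond; apply: eq_integral => x _; rewrite fE.
have FE (x : T) : fubini_F (@lebesgueRn R n) f x = (kernel_mass \_ Omega) x.
  rewrite patchE; case: ifPn => xO.
    by apply: eq_integral => y _; rewrite fE patchE xO.
  by apply: integral0_eq => y _; rewrite fE patchE (negbTE xO).
pose G := fubini_G (@lebesgueRn R n) f.
have mG : measurable_fun setT G by exact: measurable_fun_fubini_tonelli_G.
have G0 y : (0 <= G y)%E by exact: integral_ge0.
have -> : frac_perimeter alpha E Omega =
    (\int[lebesgueRn]_(y in (Omega : set T)) G y
     + \int[lebesgueRn]_(y in ~` (Omega : set T)) G y)%E.
  by congr (_ + _)%E; apply: eq_integral => y _; exact: GE.
rewrite -(@ge0_integral_setU _ _ _ _ _ _ mO (measurableC mO)); last 3 first.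
- exact: measurable_funTS mG.
- by move=> y _; exact: G0.
- by apply/disj_setPS; rewrite setICr.
rewrite setUv -(fubini_tonelli _ mf f0) [RHS]integral_mkcond.
by apply: eq_integral => x _; exact: FE.
Qed.

End kernel_measurability.

(** Every set of outer measure 0 satisfies the Caratheodory criterion, so null values and a.e.
    statements can be exchanged without checking measurability. *)
Lemma lebesgueRn_negligible (R : realType) (n : nat) (A : set 'rV[R]_n) :
  (@lebesgueRn R n).-negligible (A : set (lebesgueRn_type R n)) <->
  lebesgueRn A = 0%E.
Proof.
split=> [[B [_ B0 AB]]|A0].
  apply/eqP; rewrite eq_le measure_ge0 andbT -B0; exact: le_outer_measure.
exists A; split => //; apply: le_caratheodory_measurable => X.
rewrite -[leRHS]add0e -A0; apply: leeD; apply: le_outer_measure => x [].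
  by [].
by [].
Qed.

(** * Equality in the gradient bound at a fixed point x *)

Section pointwise.
Context (R : realType) (n : nat) (alpha : R) (E : set 'rV[R]_n).
Hypothesis alpha01 : 0 < alpha < 1.
Hypothesis mE : measurable (E : set (lebesgueRn_type R n)).

Let T := lebesgueRn_type R n.
Let c0 : 0 < mu_const n alpha. Proof. exact: mu_const_gt0. Qed.

Variable x : 'rV[R]_n.
Hypothesis Kx : (kernel_mass alpha E x < +oo)%E.

Let k (y : T) : R := frac_kernel alpha E x y.
Let g (i : 'I_n) (y : T) : R := frac_coord alpha E i x y.
Let G : 'rV[R]_n := \row_i \int[lebesgueRn]_y g i y.

Let gk y : enorm (\row_i g i y) = k y.
Proof. by apply: enorm_frac_coord; case/andP: alpha01. Qed.

Let mk : measurable_fun setT k.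
Proof.
exact: (measurableT_comp (measurable_frac_kernel alpha mE) (pair1_measurable (x : T))).
Qed.

Let mg i : measurable_fun setT (g i).
Proof.
exact: (measurableT_comp (measurable_frac_coord alpha mE i) (pair1_measurable (x : T))).
Qed.

Let ki : (@lebesgueRn R n).-integrable setT (EFin \o k).
Proof.
apply/integrableP; split; first by apply/measurable_EFinP; exact: mk.
under eq_integral => y _ do rewrite /= ger0_norm ?frac_kernel_ge0//.
exact: Kx.
Qed.

Let KE : kernel_mass alpha E x = (\int[lebesgueRn]_y k y)%:E.
Proof. by rewrite /Rintegral fineK// ge0_fin_numE// kernel_mass_ge0. Qed.

Let gradE : enorm (frac_gradient alpha E x) = mu_const n alpha * enorm G.
Proof. by rewrite /frac_gradient enormZ gtr0_norm. Qed.

Lemma enorm_frac_gradient_le :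
  ((enorm (frac_gradient alpha E x))%:E
     <= (mu_const n alpha)%:E * kernel_mass alpha E x)%E.
Proof.
rewrite KE gradE -EFinM lee_fin ler_pM2l//.
exact: (enorm_integral_le gk ki mg).
Qed.

(** The support of the kernel: the complement of [E] if x is in [E], and [E] itself otherwise. *)
Let D : set 'rV[R]_n := [set y | \1_E y != \1_E x :> R].

Lemma null_jump_of_kernel_mass0 : kernel_mass alpha E x = 0%E -> lebesgueRn D = 0%E.
Proof.
move=> K0; apply/lebesgueRn_negligible.
have mk' : measurable_fun setT (EFin \o k) by apply/measurable_EFinP; exact: mk.
have : (\int[lebesgueRn]_y `|(EFin \o k) y| = 0)%E.
  rewrite -K0; apply: eq_integral => y _.
  by rewrite /= ger0_norm ?frac_kernel_ge0.
move=> /(ae_eq_integral_abs _ measurableT mk'); apply: negligibleS => y Dy /(_ I).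
by case=> /frac_kernel_eq0 yx; move: Dy; rewrite /D /= yx eqxx.
Qed.

Let aligned : (enorm (frac_gradient alpha E x))%:E
    = ((mu_const n alpha)%:E * kernel_mass alpha E x)%E ->
  {ae lebesgueRn, forall y i, k y * G 0 i = enorm G * g i y}.
Proof.
move=> /eqP; rewrite KE gradE -EFinM eqe => /eqP/(mulfI (lt0r_neq0 c0)) GE.
exact: (enorm_integral_eq gk ki mg GE).
Qed.

(** On [D] the jump is a sign independent of y, so g(y) points along y - x, up to that one sign. *)
Let jumpE y : D y -> \1_E y - \1_E x = 1 - 2 * \1_E x :> R.
Proof.
rewrite /D /= !indicE; case: (y \in E); case: (x \in E); rewrite /= ?eqxx//= => _; lra.
Qed.

Let jump2 : (1 - 2 * \1_E x) ^+ 2 = 1 :> R.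
Proof. by rewrite indicE; case: (x \in E); rewrite /= expr2; lra. Qed.

Let jump1 : `|1 - 2 * \1_E x| = 1 :> R.
Proof. by apply/eqP; rewrite -sqr_norm_eq1 jump2. Qed.

Let D_neq y : D y -> y != x.
Proof. by apply: contraTN => /eqP ->; rewrite negbK. Qed.

Let enorm_gt0 y : y != x -> 0 < enorm (y - x).
Proof.
move=> yx; rewrite lt0r enorm_ge0 andbT.
by apply: contraNneq yx => /enorm_eq0/eqP; rewrite subr_eq0.
Qed.

(** For a.e. y in [D], y - x is parallel to G. With G_i nonzero and a second index j, this puts y on
    a hyperplane through x, which is null. *)
Lemma null_jump_of_aligned : (2 <= n)%N ->
  (enorm (frac_gradient alpha E x))%:E
    = ((mu_const n alpha)%:E * kernel_mass alpha E x)%E ->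
  lebesgueRn D = 0%E.
Proof.
move=> n2 eqG.
have [G0|G0] := eqVneq (enorm G) 0.
  apply: null_jump_of_kernel_mass0; move/eqP: eqG.
  rewrite gradE G0 mulr0 KE -EFinM eqe eq_sym mulf_eq0 (negbTE (lt0r_neq0 c0)).
  by move=> /eqP ->.
have [i Gi] : exists i, G 0 i != 0.
  apply: contrapT => /forallNP Gn; move/eqP: G0; apply.
  rewrite /enorm big1 ?sqrtr0// => i _.
  by have /negP := Gn i; rewrite negbK => /eqP ->; rewrite expr0n.
have [j ij] : exists j : 'I_n, i != j.
  have n0 : (0 < n)%N by exact: leq_trans n2.
  have [i0|i0] := eqVneq (i : nat) 0%N.
    by exists (Ordinal n2); apply/eqP => /(congr1 val) /=; rewrite i0.
  by exists (Ordinal n0); apply: contraNneq i0 => ->.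
apply/lebesgueRn_negligible.
have /lebesgueRn_negligible := lebesgueRn_hyperplane (G 0 j)
  (x 0 j * G 0 i - x 0 i * G 0 j) ij Gi.
move=> /negligibleU/(_ (aligned eqG)); apply: negligibleS => y Dy.
have [yN|yN] := pselect (y 0 j * G 0 i - y 0 i * G 0 j = x 0 j * G 0 i - x 0 i * G 0 j).
  by left.
right => /= al; apply: yN.
have : g j y * G 0 i = g i y * G 0 j.
  apply: (mulfI G0); move: (al j) (al i); move: (g j y) (g i y) (k y) => a b c h1 h2.
  by rewrite mulrA -h1 mulrA -h2 mulrAC.
rewrite /g /frac_coord (jumpE Dy) => h.
(* The nonzero scalar common to all coordinates of g(y), to be cancelled. *)
have ne : (1 - 2 * \1_E x) / enorm (y - x) `^ (n%:R + alpha + 1) != 0 :> R.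
  rewrite mulf_neq0//; first by rewrite -sqrf_eq0 jump2 oner_neq0.
  by rewrite invr_neq0// lt0r_neq0// powR_gt0// enorm_gt0// D_neq.
have : ((y - x) 0 j * G 0 i) = ((y - x) 0 i * G 0 j).
  apply: (mulfI ne); move: h; move: (_ - _ * _) (_^-1) ((y - x) 0 j) ((y - x) 0 i).
  move=> d w u v h; rewrite (_ : d * w * (u * G 0 i) = u * d * w * G 0 i); last by ring.
  by rewrite h; ring.
rewrite !mxE; move: (y 0 j) (y 0 i) (x 0 j) (x 0 i) (G 0 i) (G 0 j) => *; lra.
Qed.

Let k_gt0 y : D y -> 0 < k y.
Proof.
move=> Dy; rewrite lt0r frac_kernel_ge0 andbT; apply: contraNneq Dy.
by move/frac_kernel_eq0 => ->.
Qed.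

Let k0 y : ~ D y -> k y = 0.
Proof.
by move=> /negP; rewrite negbK => /eqP yx; rewrite /k /frac_kernel yx subrr normr0 mul0r.
Qed.

(** * Dimension one, expressed by a single index *)

Section line.
Variable i : 'I_n.
Hypothesis i_unique : forall j : 'I_n, j = i.

Let enorm_line (v : 'rV[R]_n) : enorm v = `|v 0 i|.
Proof.
rewrite /enorm (bigD1 i)//= big1 ?addr0 ?sqrtr_sqr// => j.
by rewrite (i_unique j) eqxx.
Qed.

Let g_sign y : D y ->
  exists2 w : R, 0 < w & g i y = (1 - 2 * \1_E x) * ((y 0 i - x 0 i) * w).
Proof.
move=> Dy; exists (enorm (y - x) `^ (n%:R + alpha + 1))^-1.
  by rewrite invr_gt0 powR_gt0// enorm_gt0// D_neq.
rewrite /g /frac_coord (jumpE Dy) mxE [(- x) 0 i]mxE.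
by move: (1 - _) (_ ^-1) => u w; ring.
Qed.

(** Alignment fixes the sign of y - x on [D] as that of G times the jump, so [D] is null on the
    other side; if G = 0 all of [D] is null. *)
Lemma aligned_one_sided :
  (enorm (frac_gradient alpha E x))%:E
    = ((mu_const n alpha)%:E * kernel_mass alpha E x)%E ->
  lebesgueRn (D `&` [set y : 'rV[R]_n | y 0 i < x 0 i]) = 0%E \/
  lebesgueRn (D `&` [set y : 'rV[R]_n | x 0 i < y 0 i]) = 0%E.
Proof.
move=> eqG; have [G0|G0] := eqVneq (G 0 i) 0.
  left; have D0 : lebesgueRn D = 0%E.
    apply: null_jump_of_kernel_mass0; move/eqP: eqG.
    rewrite gradE enorm_line G0 normr0 mulr0 KE -EFinM eqe eq_sym mulf_eq0.
    by rewrite (negbTE (lt0r_neq0 c0)) => /eqP ->.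
  apply/eqP; rewrite eq_le measure_ge0 andbT -D0.
  by apply: le_outer_measure => y [].
have sgn y : D y -> (forall j, k y * G 0 j = enorm G * g j y) ->
    0 < (G 0 i * (1 - 2 * \1_E x)) * (y 0 i - x 0 i).
  move=> Dy /(_ i); have [w w0 ->] := g_sign Dy; rewrite enorm_line.
  have := k_gt0 Dy; have aG : 0 < `|G 0 i| by rewrite normr_gt0.
  move: (k y) (1 - _) (y 0 i - x 0 i) (G 0 i) aG G0 => a b t p aG p0 a0 h.
  (* Up to the positive factor |G| w, the quantity is k(y) G^2, by alignment. *)
  rewrite -(pmulr_rgt0 _ (mulr_gt0 aG w0)).
  have -> : `|p| * w * (p * b * t) = `|p| * (b * (t * w)) * p by ring.
  by rewrite -h -mulrA mulr_gt0// -expr2 exprn_even_gt0.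
have [Gd|Gd] := ltP 0 (G 0 i * (1 - 2 * \1_E x)); [left|right];
  apply/lebesgueRn_negligible; apply: negligibleS (aligned eqG) => y [Dy /= yx] al.
- have := sgn y Dy al; rewrite pmulr_rgt0// subr_gt0 => xy.
  by have := lt_trans yx xy; rewrite ltxx.
- by have := sgn y Dy al; rewrite ltNge mulr_le0_ge0// subr_ge0 ltW.
Qed.

(** The sign [s] tells the side on which [D] lies. There g = s (1 - 2 chi_E(x)) k a.e., a constant
    sign times k, so no cancellation occurs in the integral. *)
Lemma one_sided_aligned (s : R) : `|s| = 1 ->
  {ae lebesgueRn, forall y : T, D y -> 0 <= s * ((y : 'rV[R]_n) 0 i - x 0 i)} ->
  (enorm (frac_gradient alpha E x))%:E
    = ((mu_const n alpha)%:E * kernel_mass alpha E x)%E.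
Proof.
move=> s1 sD; rewrite KE gradE -EFinM; congr (_ * _)%:E.
have gE : {ae lebesgueRn, forall y : T, setT y ->
    (g i y)%:E = ((s * (1 - 2 * \1_E x))%:E * (k y)%:E)%E}.
  apply: filterS sD => y sy _; rewrite -EFinM; congr (_%:E).
  have kE : k y = `|g i y| by rewrite -gk enorm_line mxE.
  have [Dy|Dy] := pselect (D y); last first.
    have := k0 Dy; rewrite kE => /eqP; rewrite normr_eq0 => /eqP ->.
    by rewrite normr0 mulr0.
  rewrite kE; have [w w0 ->] := g_sign Dy.
  have := sy Dy; move: (y 0 i - x 0 i) => t st.
  rewrite !normrM jump1 mul1r (gtr0_norm w0).
  have -> : `|t| = s * t by rewrite -(ger0_norm st) normrM s1 mul1r.
  have ss : s * s = 1 by apply/eqP; rewrite -expr2 sqr_norm_eq1 s1.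
  move: (1 - _) => b; rewrite -[LHS]mul1r -ss; ring.
have mge : measurable_fun setT (EFin \o g i).
  by apply/measurable_EFinP; exact: mg.
have mke : measurable_fun setT (fun y => (s * (1 - 2 * \1_E x))%:E * (k y)%:E)%E.
  by apply: measurable_funeM; apply/measurable_EFinP; exact: mk.
rewrite enorm_line /G mxE /Rintegral.
rewrite (ae_eq_integral _ _ measurableT mge mke gE) (integralZl measurableT ki).
rewrite fineM//; last exact: integrable_fin_num ki.
rewrite normrM normrM s1 mul1r.
rewrite jump1 mul1r ger0_norm// fine_ge0//; apply: integral_ge0 => y _.
by rewrite lee_fin frac_kernel_ge0.
Qed.

End line.
End pointwise.

(** * Integration over Omega *)

Lemma jump_set_in (R : realType) (n : nat) (E : set 'rV[R]_n) (x : 'rV[R]_n) :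
  E x -> [set y | \1_E y != \1_E x :> R] = ~` E.
Proof.
move=> Ex; apply/seteqP; split=> y /=; rewrite !indicE (mem_set Ex).
  by move=> yx Ey; move: yx; rewrite (mem_set Ey) eqxx.
by move=> Ey; rewrite (memNset Ey) eq_sym oner_neq0.
Qed.

Lemma jump_set_notin (R : realType) (n : nat) (E : set 'rV[R]_n) (x : 'rV[R]_n) :
  ~ E x -> [set y | \1_E y != \1_E x :> R] = E.
Proof.
move=> Ex; apply/seteqP; split=> y /=; rewrite !indicE (memNset Ex).
  by case: (boolP (y \in E)) => [/set_mem//|]; rewrite eqxx.
by move=> Ey; rewrite (mem_set Ey) oner_neq0.
Qed.

Section global.
Context (R : realType) (n : nat) (alpha : R) (Omega E : set 'rV[R]_n).
Hypothesis alpha01 : 0 < alpha < 1.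
Hypothesis mE : measurable (E : set (lebesgueRn_type R n)).
Hypothesis mO : measurable (Omega : set (lebesgueRn_type R n)).
Hypothesis Poo : (frac_perimeter alpha E Omega < +oo)%E.

Let T := lebesgueRn_type R n.
Let c := mu_const n alpha.

Let K (x : T) : \bar R := kernel_mass alpha E x.
Let f (x : T) : R := enorm (frac_gradient alpha E (x : 'rV[R]_n)).

Let c0 : (0 <= c%:E)%E. Proof. by rewrite lee_fin ltW// mu_const_gt0. Qed.

Let mK : measurable_fun (Omega : set T) K.
Proof. exact: measurable_funTS (measurable_kernel_mass alpha mE). Qed.

Let mcK : measurable_fun (Omega : set T) (fun x => c%:E * K x)%E.
Proof. exact: measurable_funeM. Qed.

Let cK0 x : (0 <= c%:E * K x)%E.
Proof. exact: (mule_ge0 c0 (kernel_mass_ge0 _ _ _)). Qed.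

Let mf : measurable_fun (Omega : set T) f.
Proof. exact: measurable_funTS (measurable_enorm_frac_gradient alpha mE). Qed.

Let mf' : measurable_fun (Omega : set T) (EFin \o f).
Proof. by apply/measurable_EFinP; exact: mf. Qed.

Let f0 x : 0 <= f x. Proof. exact: enorm_ge0. Qed.

Let PE : (c%:E * frac_perimeter alpha E Omega =
  \int[lebesgueRn]_(x in (Omega : set T)) (c%:E * K x))%E.
Proof.
rewrite (frac_perimeterE alpha mE mO) (ge0_integralZl _ mO mK _ c0)//.
by move=> x _; exact: kernel_mass_ge0.
Qed.

Lemma kernel_mass_ae_lty : {ae lebesgueRn, forall x : T, Omega x -> (K x < +oo)%E}.
Proof.
have Ki : (@lebesgueRn R n).-integrable (Omega : set T) K.
  apply/integrableP; split; first exact: mK.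
  under eq_integral => x _ do rewrite gee0_abs ?kernel_mass_ge0//.
  by move: Poo; rewrite (frac_perimeterE alpha mE mO).
have := integrable_ae mO Ki; apply: filterS => x + Ox => /(_ Ox) /fin_numPlt.
by case/andP.
Qed.

Let ae_le : {ae lebesgueRn, forall x : T, Omega x -> ((f x)%:E <= c%:E * K x)%E}.
Proof.
apply: filterS kernel_mass_ae_lty => x + Ox => /(_ Ox).
exact: enorm_frac_gradient_le.
Qed.

Lemma L1norm_frac_gradient_le :
  (L1norm Omega (frac_gradient alpha E) <= c%:E * frac_perimeter alpha E Omega)%E.
Proof.
rewrite PE; apply: (ae_ge0_le_integral mO _ mf' _ mcK ae_le) => x _.
  by rewrite lee_fin f0.
exact: cK0.
Qed.

(** Finiteness of [K x] is carried along because the pointwise lemmas assume it. *)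
Lemma L1norm_frac_gradient_eq :
  (L1norm Omega (frac_gradient alpha E) = c%:E * frac_perimeter alpha E Omega)%E
  <-> {ae lebesgueRn, forall x : T, Omega x ->
        (K x < +oo)%E /\ (f x)%:E = (c%:E * K x)%E}.
Proof.
split=> [L1E|fE].
  have cKoo : (\int[lebesgueRn]_(x in (Omega : set T)) (c%:E * K x) < +oo)%E.
    by rewrite -PE; apply: lte_mul_pinfty => //.
  move: L1E; rewrite PE.
  move=> /(ge0_integral_eq_ae mO mf mcK f0 cK0 ae_le cKoo).
  by apply: filterS2 kernel_mass_ae_lty => x h1 h2 Ox; split; [exact: h1|exact: h2].
rewrite PE; apply: (ge0_ae_eq_integral mO mf' mcK).
- by move=> x _; rewrite lee_fin f0.
- by move=> x _; exact: cK0.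
- by apply: filterS fE => x h Ox; exact: (h Ox).2.
Qed.

End global.

(** Part (i) asks for a nonempty [Omega]: for an empty one both sides are 0. *)
Theorem corollary2p11 (R : realType) (alpha : R) (halpha : 0 < alpha < 1) :
  (forall (n : nat) (Omega E : set 'rV[R]_n),
      (2 <= n)%N ->
      open Omega -> Omega !=set0 ->
      measurable (E : set (lebesgueRn_type R n)) ->
      (frac_perimeter alpha E Omega < +oo)%E ->
      (0 < lebesgueRn E)%E ->
      (0 < lebesgueRn (~` E))%E ->
      (L1norm Omega (frac_gradient alpha E)
         < (mu_const n alpha)%:E * frac_perimeter alpha E Omega)%E)
  /\
  (forall Omega E : set 'rV[R]_1,
      open Omega ->
      measurable (E : set (lebesgueRn_type R 1)) ->
      (frac_perimeter alpha E Omega < +oo)%E ->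
      (L1norm Omega (frac_gradient alpha E)
         = (mu_const 1 alpha)%:E * frac_perimeter alpha E Omega)%E
      <->
      {ae lebesgueRn, forall x : 'rV[R]_1, (Omega `&` E) x ->
         lebesgueRn ([set y : 'rV[R]_1 | y 0 0 < x 0 0] `\` E) = 0%E \/
         lebesgueRn ([set y : 'rV[R]_1 | x 0 0 < y 0 0] `\` E) = 0%E}
      /\
      {ae lebesgueRn, forall x : 'rV[R]_1, (Omega `\` E) x ->
         lebesgueRn ([set y : 'rV[R]_1 | y 0 0 < x 0 0] `&` E) = 0%E \/
         lebesgueRn ([set y : 'rV[R]_1 | x 0 0 < y 0 0] `&` E) = 0%E}).
Proof.
split=> [n Omega E n2 oO O0 mE Poo E0 CE0|Omega E oO mE Poo].
  have mO := measurable_open oO.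
  rewrite lt_neqAle (L1norm_frac_gradient_le halpha mE mO Poo) andbT.
  apply/eqP => /(L1norm_frac_gradient_eq halpha mE mO Poo) aeq.
  have T0 : (0 < @lebesgueRn R n setT)%E.
    by apply: (lt_le_trans E0); exact: le_outer_measure.
  have := lebesgueRn_open_gt0 oO O0 T0.
  apply/negP; rewrite -leNgt le_eqVlt; apply/orP; left; apply/eqP.
  (* Equality at any x of [Omega] would make [E] or its complement null, so all of [Omega] lies in
     the exceptional null set, against its positive measure. *)
  apply/lebesgueRn_negligible; apply: negligibleS aeq => x Ox /(_ Ox) [Kx xE].
  have D0 := null_jump_of_aligned halpha mE Kx n2 xE.
  have [Ex|Ex] := pselect (E x).
    by move: CE0; rewrite -(jump_set_in Ex) D0 ltxx.
  by move: E0; rewrite -(jump_set_notin Ex) D0 ltxx.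
have mO := measurable_open oO.
have i1 (j : 'I_1) : j = 0 by rewrite ord1.
have inE (x : 'rV[R]_1) (A : set 'rV[R]_1) : E x ->
    A `\` E = [set y | \1_E y != \1_E x :> R] `&` A.
  by move=> Ex; rewrite (jump_set_in Ex) setDE setIC.
have notinE (x : 'rV[R]_1) (A : set 'rV[R]_1) : ~ E x ->
    A `&` E = [set y | \1_E y != \1_E x :> R] `&` A.
  by move=> Ex; rewrite (jump_set_notin Ex) setIC.
split.
  move=> /(L1norm_frac_gradient_eq halpha mE mO Poo) aeq.
  split; apply: filterS aeq => x h [Ox Ex]; have [Kx xE] := h Ox.
    rewrite !(inE x)//; exact: (aligned_one_sided halpha mE Kx i1 xE).
  rewrite !(notinE x)//; exact: (aligned_one_sided halpha mE Kx i1 xE).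
move=> [aeE aeCE]; apply/(L1norm_frac_gradient_eq halpha mE mO Poo).
have Kae := kernel_mass_ae_lty mE mO Poo.
(* Conditions (a) and (b) merge into one about the jump set, since x is either in [E] or not. *)
have one_sided : {ae lebesgueRn, forall x : 'rV[R]_1, Omega x ->
    lebesgueRn ([set y | \1_E y != \1_E x :> R]
      `&` [set y : 'rV[R]_1 | y 0 0 < x 0 0]) = 0%E \/
    lebesgueRn ([set y | \1_E y != \1_E x :> R]
      `&` [set y : 'rV[R]_1 | x 0 0 < y 0 0]) = 0%E}.
  apply: negligibleS (negligibleU aeE aeCE) => x /not_implyP[Ox side].
  have [Ex|Ex] := pselect (E x).
    by left=> /(_ (conj Ox Ex)) h; apply: side; rewrite -!(inE x).
  by right=> /(_ (conj Ox Ex)) h; apply: side; rewrite -!(notinE x).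
apply: filterS2 Kae one_sided => x h1 h2 Ox; have Kx := h1 Ox; split => //.
(* If the left part is null the jump set lies to the right of x, so s = 1; otherwise s = -1. *)
case: (h2 Ox) => /lebesgueRn_negligible side.
- apply: (one_sided_aligned halpha mE Kx i1 (s := 1)); first exact: normr1.
  apply: negligibleS side => y /not_implyP[Dy /negP].
  by rewrite mul1r subr_ge0 -ltNge => yx; split.
- apply: (one_sided_aligned halpha mE Kx i1 (s := -1)); first exact: normrN1.
  apply: negligibleS side => y /not_implyP[Dy /negP].
  by rewrite mulN1r oppr_ge0 subr_le0 -ltNge => yx; split.
Qed.
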